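(* Let $A$ be a random matrix in $\mathbb{R}^{n\times n}$, let $\mathcal{C}\subset\mathbb{R}^{n\times n}$, let $Z^*\in\operatorname{argmax}_{Z\in\mathcal{C}}\langle \mathbb{E}A,Z\rangle$ and $\hat Z\in\operatorname{argmax}_{Z\in\mathcal{C}}\langle A,Z\rangle$. Assume that $\mathcal{C}$ is star-shaped in $Z^*$. Then for all $0<\Delta<1$, with probability at least $1-\Delta$, it holds that $\langle \mathbb{E}A, Z^*-\hat Z\rangle\le r^*(\Delta)$.
   Context: $\langle A,B\rangle=\sum_{i,j}A_{ij}B_{ij}$ for real matrices. The set $\mathcal{C}$ is star-shaped in $Z^*$ if for all $Z\in\mathcal{C}$ the segment $[Z,Z^*]$ is contained in $\mathcal{C}$. The maximizers $Z^*$ (the oracle) and $\hat Z$ (the estimator) are assumed to exist. For $0<\Delta<1$, the fixed point complexity parameter is $$r^*(\Delta)=\inf\left(r>0:\ \mathbb{P}\left[\sup_{Z\in\mathcal{C}:\ \langle \mathbb{E}A,Z^*-Z\rangle\le r}\langle A-\mathbb{E}A,Z-Z^*\rangle\le \tfrac12 r\right]\ge 1-\Delta\right).$$ *)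

(* Defs.v *)
From HB Require Import structures.
From mathcomp Require Import all_boot all_order all_algebra.
From mathcomp Require Import all_classical all_reals all_analysis.

Set Implicit Arguments.
Unset Strict Implicit.
Unset Printing Implicit Defensive.

Import Order.TTheory GRing.Theory Num.Theory.
Import numFieldNormedType.Exports.

Local Open Scope classical_set_scope.
Local Open Scope ring_scope.

Definition mx_inner (R : realType) (n : nat) (A B : 'M[R]_n) : R :=
  \sum_(i < n) \sum_(j < n) A i j * B i j.

Definition argmax (R : realType) (T : Type) (C : set T) (f : T -> R) : set T :=
  [set Z | C Z /\ forall Z', C Z' -> f Z' <= f Z].

Definition star_shaped (R : realType) (n : nat) (C : set 'M[R]_n)
    (Z0 : 'M[R]_n) : Prop :=
  forall Z, C Z ->
  forall t : R, 0 <= t <= 1 -> C ((1 - t) *: Z + t *: Z0).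

(* [P.-integrable] includes measurability, so this says that [A] is a random
   matrix whose entries all have a finite expectation. *)
Definition integrable_mx (d : measure_display) (T : measurableType d)
    (R : realType) (P : probability T R) (n : nat) (A : T -> 'M[R]_n) : Prop :=
  forall i j, P.-integrable setT (EFin \o (fun w => A w i j)).

Definition mx_expectation (d : measure_display) (T : measurableType d)
    (R : realType) (P : probability T R) (n : nat) (A : T -> 'M[R]_n) :
    'M[R]_n :=
  \matrix_(i, j) fine ('E_P[fun w => A w i j])%E.

(* "[S] holds with probability at least [p]".  When [S] is not known to be
   measurable (here it depends on a pointwise choice of maximizers), this asks
   for an event contained in [S]; on measurable sets it is [p%:E <= P S], see
   [with_prob_geE]. *)
Definition with_prob_ge (d : measure_display) (T : measurableType d)
    (R : realType) (P : probability T R) (p : R) (S : set T) : Prop :=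
  exists E : set T, [/\ measurable E, E `<=` S & (p%:E <= P E)%E].

Lemma with_prob_geE (d : measure_display) (T : measurableType d)
    (R : realType) (P : probability T R) (p : R) (S : set T) :
  measurable S -> with_prob_ge P p S <-> (p%:E <= P S)%E.
Proof.
move=> mS; split=> [[E [mE ES pE]]|pS]; last by exists S; split.
by apply: le_trans pE _; exact: le_measure (mem_set mE) (mem_set mS) ES.
Qed.

(* The fixed point parameter $r^*(\Delta)$.  The supremum and the infimum are
   taken in [\bar R]: the supremum may be infinite, and the infimum is [+oo]
   when no radius is admissible.  The event is measurable although [C] is
   arbitrary: the supremum of the continuous maps
   [Z |-> mx_inner (A w - EA) (Z - Zs)] over a subset of the separable space of
   matrices equals the supremum over a countable dense subset of it. *)
Definition fixed_point_radius (d : measure_display) (T : measurableType d)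
    (R : realType) (P : probability T R) (n : nat) (A : T -> 'M[R]_n)
    (C : set 'M[R]_n) (Zs : 'M[R]_n) (Delta : R) : \bar R :=
  let EA := mx_expectation P A in
  let dev (r : R) (w : T) := ereal_sup
    [set (mx_inner (A w - EA) (Z - Zs))%:E | Z in
       [set Z | C Z /\ mx_inner EA (Zs - Z) <= r]] in
  ereal_inf [set r%:E | r in [set r : R | 0 < r /\
    ((1 - Delta)%:E <= P [set w | (dev r w <= (2^-1 * r)%:E)%E])%E]].

(* Main.v *)
(* Let [r] be a radius whose event [E r] = {sup over excess <= r of the deviation
   <= r / 2} has probability at least [1 - Delta].  On [E r], a point of excess
   [g >= r] can be shrunk towards [Zs] until its excess is [r]; rescaling, its
   deviation is at most [g / 2].  By optimality the deviation of [Zhat] is at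
   least its excess, so that excess is at most [r].  The same scaling shows that
   [E r] increases with [r], so continuity from above along
   [E (rs + 1 / (k + 1))] gives the bound by the infimum [rs] of the admissible
   radii at no loss of probability. *)
Require Import Defs.
From mathcomp Require Import all_boot all_order all_algebra.
From mathcomp Require Import all_classical all_reals all_analysis.
From mathcomp Require Import lra.

Set Implicit Arguments.
Unset Strict Implicit.
Unset Printing Implicit Defensive.

Import Order.TTheory GRing.Theory Num.Theory.
Import numFieldNormedType.Exports.

Local Open Scope classical_set_scope.
Local Open Scope ring_scope.

Lemma mx_innerC (R : realType) (n : nat) (A B : 'M[R]_n) :
  mx_inner A B = mx_inner B A.
Proof. by apply: eq_bigr => i _; apply: eq_bigr => j _; rewrite mulrC. Qed.

Lemma mx_innerDr (R : realType) (n : nat) (A B B' : 'M[R]_n) :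
  mx_inner A (B + B') = mx_inner A B + mx_inner A B'.
Proof.
rewrite /mx_inner -big_split/=; apply: eq_bigr => i _.
by rewrite -big_split/=; apply: eq_bigr => j _; rewrite mxE mulrDr.
Qed.

Lemma mx_innerZr (R : realType) (n : nat) (A B : 'M[R]_n) (a : R) :
  mx_inner A (a *: B) = a * mx_inner A B.
Proof.
rewrite /mx_inner mulr_sumr; apply: eq_bigr => i _.
by rewrite mulr_sumr; apply: eq_bigr => j _; rewrite mxE mulrCA.
Qed.

Lemma mx_innerNr (R : realType) (n : nat) (A B : 'M[R]_n) :
  mx_inner A (- B) = - mx_inner A B.
Proof. by rewrite -scaleN1r mx_innerZr mulN1r. Qed.

Lemma mx_innerBl (R : realType) (n : nat) (A A' B : 'M[R]_n) :
  mx_inner (A - A') B = mx_inner A B - mx_inner A' B.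
Proof. by rewrite mx_innerC mx_innerDr mx_innerNr !(mx_innerC B). Qed.

Lemma continuous_mx_innerl (R : realType) (n : nat) (B : 'M[R]_n) :
  continuous (fun M : 'M[R]_n => mx_inner M B).
Proof.
have cst0 : continuous (0 : 'M[R]_n -> R^o) by exact: cst_continuous.
have addc (f g : 'M[R]_n -> R^o) :
  continuous f -> continuous g -> continuous (f + g).
  by move=> cf cg M; apply: continuousD; [exact: cf | exact: cg].
rewrite (_ : (fun M => _) =
    \sum_i \sum_j (fun M : 'M[R]_n => M i j * B i j)).
  elim/big_ind : _ => // i _; elim/big_ind : _ => // j _ M.
  exact: (continuousM (@coord_continuous R n n i j M)
    (@cst_continuous _ R^o (B i j) M)).
apply/funext => M; rewrite /mx_inner fct_sumE; apply: eq_bigr => i _.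
by rewrite fct_sumE.
Qed.

(* Every open set of matrices is a union of balls with rational centres and
   radii [1 / (k + 1)], hence a countable union of boxes. *)
Lemma measurable_mx_preimage_open (d : measure_display) (T : measurableType d)
    (R : realType) (m n : nat) (A : T -> 'M[R]_(m, n)) (U : set 'M[R]_(m, n)) :
  (forall i j, measurable_fun setT (fun w => A w i j)) ->
  open U -> measurable (A @^-1` U).
Proof.
move=> mA oU.
pose B (q : 'M[rat]_(m, n) * nat) : set 'M[R]_(m, n) :=
  ball (map_mx ratr q.1 : 'M[R]_(m, n)) q.2.+1%:R^-1.
have mB q : measurable (A @^-1` B q).
  rewrite (_ : _ @^-1` _ = \bigcap_i \bigcap_j
    ((fun w => A w i j) @^-1` ball (ratr (q.1 i j) : R) q.2.+1%:R^-1)).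
    apply: fin_bigcap_measurable => // i _.
    apply: fin_bigcap_measurable => // j _.
    rewrite -[X in measurable X]setTI; apply: mA => //.
    exact: measurable_realfun.measurable_ball.
  apply/seteqP; split=> w; first by case=> _ Aw i _ j _; have := Aw i j; rewrite mxE.
  by move=> Aw; split=> [|i j]; [rewrite invr_gt0 | rewrite mxE; exact: Aw].
(* Replacing the balls not contained in [U] by the empty set lets the union run over the whole
   countable index type. *)
pose F q := if `[< B q `<=` U >] then A @^-1` B q else set0.
rewrite (_ : A @^-1` U = \bigcup_q F q).
  apply: countable_bigcupT_measurable => // q; rewrite /F.
  by case: ifP => _; [exact: mB | exact: measurable0].
apply/seteqP; split=> w; last first.
  by case=> q _; rewrite /F; case: ifPn => // /asboolP BU /BU.
move=> UAw; have /nbhs_ballP[e /= e0 eU] : nbhs (A w) U by exact: open_nbhs_nbhs.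
(* With [1 / (k + 1) < e / 2], any ball of radius [1 / (k + 1)] containing [A w] lies in the
   [e]-ball around [A w]. *)
have [k] := ltr_add_invr (divr_gt0 e0 (ltr0Sn R 1)); rewrite add0r => ke.
have k0 : 0 < k.+1%:R^-1 :> R by rewrite invr_gt0.
have /choice[Q AQ] (ij : 'I_m * 'I_n) : exists q : rat,
    ball (A w ij.1 ij.2) k.+1%:R^-1 (ratr q : R).
  have [q] := @rat_in_itvoo R (A w ij.1 ij.2) (A w ij.1 ij.2 + k.+1%:R^-1)
    ltac:(by rewrite ltrDl).
  rewrite in_itv/= => /andP[q1 q2]; exists q.
  by rewrite /ball/= distrC ger0_norm ?subr_ge0 ?ltW// ltrBlDl.
pose q : 'M[rat]_(m, n) * nat := (\matrix_(i, j) Q (i, j), k).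
have BA : B q (A w).
  by split=> // i j; rewrite !mxE; apply: ball_sym; exact: (AQ (i, j)).
exists q => //; rewrite /F ifT//; apply/asboolP => M BM; apply: eU.
have : ball (A w) (k.+1%:R^-1 + k.+1%:R^-1) M.
  by apply: ball_triangle BM; exact: ball_sym.
by apply: le_ball; rewrite [leRHS]splitr lerD// ltW.
Qed.

(** The supremum exceeds [c] iff a single [Z] in [D] does, and each [Z] cuts out an open half-space
    of values of [A w]. An arbitrary union of these is open, so [D] can be any set. *)
Lemma measurable_sup_dev (d : measure_display) (T : measurableType d)
    (R : realType) (n : nat) (A : T -> 'M[R]_n) (M Z0 : 'M[R]_n)
    (D : set 'M[R]_n) (c : R) :
  (forall i j, measurable_fun setT (fun w => A w i j)) ->
  measurable
    [set w | (ereal_sup [set (mx_inner (A w - M) (Z - Z0))%:E | Z in D] <=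
              c%:E)%E].
Proof.
move=> mA.
pose U := \bigcup_(Z in D)
  ((fun B => mx_inner B (Z - Z0)) @^-1` [set x | c + mx_inner M (Z - Z0) < x]).
rewrite (_ : [set w | _] = ~` (A @^-1` U)).
  apply/measurableC/measurable_mx_preimage_open => //.
  apply: bigcup_open => Z _; apply: open_comp; last exact: open_gt.
  by move=> B _; exact: continuous_mx_innerl.
apply/seteqP; split=> w /=.
  move=> supc [Z DZ] /=; apply/negP; rewrite -leNgt -lerBlDr -mx_innerBl -lee_fin.
  by apply: le_trans supc; apply: ereal_sup_ubound; exists Z.
move=> AU; apply: ge_ereal_sup => _ [Z DZ <-].
rewrite lee_fin mx_innerBl lerBlDr leNgt; apply/negP => lt; apply: AU.
by exists Z.
Qed.

(** Pointwise form, free of extended reals, of the event in the fixed point radius: there [M] is the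
    expectation and [B] the centred matrix. *)
Definition local_dev_le (R : realType) (n : nat) (C : set 'M[R]_n)
    (M B Zs : 'M[R]_n) (r : R) : Prop :=
  forall Z, C Z -> mx_inner M (Zs - Z) <= r -> mx_inner B (Z - Zs) <= 2^-1 * r.

(* Shrink [Z] towards [Zs] until its excess is exactly [r], and rescale. *)
Lemma local_dev_le_outside (R : realType) (n : nat) (C : set 'M[R]_n)
    (M B Zs Z : 'M[R]_n) (r : R) :
  star_shaped C Zs -> 0 < r -> local_dev_le C M B Zs r -> C Z ->
  r <= mx_inner M (Zs - Z) ->
  mx_inner B (Z - Zs) <= 2^-1 * mx_inner M (Zs - Z).
Proof.
move=> starC r0 devr CZ; set g := mx_inner M (Zs - Z) => rg.
have g0 : 0 < g by exact: lt_le_trans rg.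
(* [1 - r / g] is the weight put on [Zs], so that [Z - Zs] gets scaled by [r / g]. *)
have s01 : 0 <= 1 - r / g <= 1.
  by rewrite subr_ge0 ler_pdivrMr// mul1r rg/= gerBl divr_ge0// ltW.
have := devr _ (starC Z CZ _ s01).
set Z' := (_ *: Z + _ *: Zs).
have ZB : Z' - Zs = (r / g) *: (Z - Zs).
  by rewrite /Z' subKr scalerBl scale1r scalerBr addrA addrAC addrK.
have BZ : Zs - Z' = (r / g) *: (Zs - Z) by rewrite -opprB ZB -scalerN opprB.
rewrite BZ ZB !mx_innerZr -/g divfK ?gt_eqF// lexx => /(_ isT).
by rewrite mulrAC ler_pdivrMr// [leRHS]mulrAC (mulrC r) ler_pM2r.
Qed.

(** Points of excess at most [r] have deviation at most [r / 2]. Those of excess between [r] and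
    [r'] have deviation at most half their excess, hence at most [r' / 2]. *)
Lemma local_dev_le_mono (R : realType) (n : nat) (C : set 'M[R]_n)
    (M B Zs : 'M[R]_n) (r r' : R) :
  star_shaped C Zs -> 0 < r -> r <= r' ->
  local_dev_le C M B Zs r -> local_dev_le C M B Zs r'.
Proof.
move=> starC r0 rr' devr Z CZ Zr'.
have [Zr|rZ] := leP (mx_inner M (Zs - Z)) r.
  by apply: le_trans (devr Z CZ Zr) _; rewrite ler_pM2l ?invr_gt0.
apply: le_trans (local_dev_le_outside starC r0 devr CZ (ltW rZ)) _.
by rewrite ler_pM2l ?invr_gt0.
Qed.

(** With [g] the excess of [Z], its deviation is [mx_inner B (Z - Zs) + g], at least [g] by
    optimality. If [g > r], it is also at most [g / 2], which is absurd as [g > 0]. *)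
Lemma argmax_excess_le (R : realType) (n : nat) (C : set 'M[R]_n)
    (M B Zs Z : 'M[R]_n) (r : R) :
  star_shaped C Zs -> C Zs -> argmax C (mx_inner B) Z -> 0 < r ->
  local_dev_le C M (B - M) Zs r -> mx_inner M (Zs - Z) <= r.
Proof.
move=> starC CZs [CZ /(_ _ CZs) BZ] r0 devr; rewrite leNgt; apply/negP => rZ.
have := local_dev_le_outside starC r0 devr CZ (ltW rZ).
have g0 := lt_trans r0 rZ; move: g0 BZ.
rewrite mx_innerBl !mx_innerDr !mx_innerNr; lra.
Qed.

Theorem theorem1 (d : measure_display) (T : measurableType d) (R : realType)
    (P : probability T R) (n : nat) (A : T -> 'M[R]_n) (C : set 'M[R]_n)
    (Zs : 'M[R]_n) (Zhat : T -> 'M[R]_n)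
    (intA : integrable_mx P A)
    (ZsP : argmax C (mx_inner (mx_expectation P A)) Zs)
    (ZhatP : forall w, argmax C (mx_inner (A w)) (Zhat w))
    (starC : star_shaped C Zs)
    (Delta : R) (Delta01 : 0 < Delta < 1) :
  with_prob_ge P (1 - Delta)
    [set w | ((mx_inner (mx_expectation P A) (Zs - Zhat w))%:E
              <= fixed_point_radius P A C Zs Delta)%E].
Proof.
have [CZs _] := ZsP; set EA := mx_expectation P A.
have mA i j : measurable_fun setT (fun w => A w i j).
  by apply/measurable_realfun.measurable_EFinP; exact: measurable_int (intA i j).
pose dev (r : R) (w : T) := ereal_sup
  [set (mx_inner (A w - EA) (Z - Zs))%:E | Z in
    [set Z | C Z /\ mx_inner EA (Zs - Z) <= r]].
pose E (r : R) : set T := [set w | (dev r w <= (2^-1 * r)%:E)%E].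
have mE r : measurable (E r) by exact: measurable_sup_dev.
have EP r w : E r w <-> local_dev_le C EA (A w - EA) Zs r.
  split=> [Erw Z CZ Zr|devr].
    rewrite -lee_fin; apply: le_trans Erw.
    by apply: ereal_sup_ubound; exists Z.
  apply: ge_ereal_sup => _ [Z [CZ Zr] <-]; rewrite lee_fin; exact: devr.
have Emono r r' : 0 < r -> r <= r' -> E r `<=` E r'.
  by move=> r0 rr' w /EP devr; apply/EP; exact: local_dev_le_mono devr.
pose S := [set r : R | 0 < r /\ ((1 - Delta)%:E <= P (E r))%E].
rewrite (_ : fixed_point_radius _ _ _ _ _ =
  ereal_inf [set r%:E | r in S])//.
have inf_ge0 : (0 <= ereal_inf [set r%:E | r in S])%E.
  by apply: le_ereal_inf_tmp => _ [r [r0 _] <-]; rewrite lee_fin ltW.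
(* The value [-oo] is excluded by [inf_ge0]; for [+oo] the bound is void and the whole space serves
   as event. *)
case infS : (ereal_inf _) inf_ge0 => [rs||]//; last first.
  move=> _; exists setT; split => //; first by move=> w _ /=; rewrite leey.
  by rewrite probability_setT lee_fin; lra.
rewrite lee_fin => rs0.
(* The infimum [rs] may be 0 or fail to be admissible. Each [r_ k] lies strictly above it, hence
   above some admissible radius, whose probability bound [Emono] carries up to [r_ k]. *)
pose r_ k : R := rs + k.+1%:R^-1.
have r_gt k : rs < r_ k by rewrite ltrDl invr_gt0.
have r_gt0 k : 0 < r_ k by exact: le_lt_trans (r_gt k).
have PE k : ((1 - Delta)%:E <= P (E (r_ k)))%E.
  have : (ereal_inf [set r%:E | r in S] < (r_ k)%:E)%E by rewrite infS lte_fin.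
  move=> /ereal_inf_ltP[_ [r [r0 Pr] <-]]; rewrite lte_fin => rk.
  apply: le_trans Pr _; apply: le_measure; rewrite ?inE//.
  by apply: Emono => //; exact: ltW.
have mEcap : measurable (\bigcap_k E (r_ k)) by exact: bigcapT_measurable.
have cvgE : P (E (r_ k)) @[k --> \oo] --> P (\bigcap_k E (r_ k)).
  apply: (@nonincreasing_cvg_mu _ _ _ P (E \o r_)) => //=.
    by rewrite (le_lt_trans (probability_le1 _ (mE _))) ?ltry.
  move=> i j ij; apply/subsetPset/Emono => //.
  by rewrite lerD2l lef_pV2 ?posrE// ler_nat.
exists (\bigcap_k E (r_ k)); split => //.
  (* An excess above [rs] would exceed some [r_ k], against [argmax_excess_le] on [E (r_ k)]. *)
  move=> w Ew /=; rewrite lee_fin leNgt; apply/negP => /ltr_add_invr[k].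
  apply/negP; rewrite -leNgt.
  by apply: argmax_excess_le (ZhatP w) (r_gt0 k) _ => //; apply/EP; exact: Ew.
rewrite -(cvg_lim _ cvgE)//; apply: lime_ge.
  by apply/cvg_ex; eexists; exact: cvgE.
exact: nearW.
Qed.
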